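(* Let $(U,\mathcal{D})$ be a tight interdependent orbit union with $\mathcal{D}=\{D_1,\ldots,D_m\}$, $m\geq 3$, and let $3\leq n\leq m$ and $s\leq n-1$ be such that $\{D_1,\ldots,D_{n-1}\}$ is the vertex set of a connected component of the graph $\mathcal{O}(U,\mathcal{D})-D_n$ and the frames among $D_1,\ldots,D_{n-1}$ adjacent to $D_n$ in $\mathcal{O}(U,\mathcal{D})$ are exactly $D_s,\ldots,D_{n-1}$. Let $U_n$, $\Phi_n$ and $Q$ be as in the context, let $G^*$ be a subgroup of $\mathrm{Aut}_{\mathcal{D}}(U)$, and let $H=\{\Psi\in G^*:\Psi_n=\mathrm{id}_{U_n}\}$. Then $H$ is a normal subgroup of $G^*$, the factor group $G^*/H$ is isomorphic to the group $\{\Phi_n:\Phi\in G^*\}$, and consequently $$|G^*|=\left|\{\Phi_n:\Phi\in G^*\}\right|\cdot\left|\{\Psi|_Q:\Psi\in H\}\right|.$$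
   Context: All ordered sets are finite; $x\sim y$ means $x,y$ are comparable. A nonempty $A\subseteq P$ is order-autonomous if for every $z\in P\setminus A$: $z<a$ for some $a\in A$ implies $z<A$ (below all of $A$), and $z>a$ for some $a\in A$ implies $z>A$; nontrivial means $|A|\notin\{1,|P|\}$. A structured ordered set $(P,\mathcal{D})$ is an ordered set with a partition $\mathcal{D}$ of $P$ into antichains (frames); $\mathrm{Aut}_{\mathcal{D}}(P)$ is the group of automorphisms $\Phi$ with $\Phi[D]=D$ for all $D\in\mathcal{D}$, whose orbits are the $\mathcal{D}$-orbits. Distinct $\mathcal{D}$-orbits $C,E$ are directly interdependent if some $c\in C$, $e\in E$ satisfy $c<e$ or $e<c$ and some $c'\in C,e'\in E$ are incomparable. The orbit graph $\mathcal{O}(P,\mathcal{D})$ has the $\mathcal{D}$-orbits as vertices, adjacent iff directly interdependent. $(P,\mathcal{D})$ is an interdependent orbit union if its orbit graph is connected, and tight if each frame is one $\mathcal{D}$-orbit and no frame contains a nontrivial order-autonomous antichain of $P$. Construction: let $W=U\setminus(D_n\cup\cdots\cup D_m)$ with induced order. For $j\in\{s,\ldots,n-1\}$ let $A^j_1,\ldots,A^j_{\ell_j}$ be the maximal subsets of $D_j$ that are order-autonomous antichains in $W$; they partition $D_j$, and every $\Phi\in\mathrm{Aut}_{\mathcal{D}}(U)$ maps each $A^j_i$ onto some $A^j_k$. Fix $a^j_i\in A^j_i$ and put $U_n=D_1\cup\cdots\cup D_{s-1}\cup\{a^j_i: s\leq j\leq n-1, 1\leq i\leq \ell_j\}$.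 For $\Phi\in\mathrm{Aut}_{\mathcal{D}}(U)$, $\Phi_n:U_n\to U_n$ agrees with $\Phi$ on $D_1\cup\cdots\cup D_{s-1}$ and maps $a^j_i$ to the unique element of $\Phi[A^j_i]\cap U_n$. Finally $Q=D_s\cup\cdots\cup D_m$. *)

(* Defs.v *)
From mathcomp Require Import all_boot all_order all_fingroup.

Set Implicit Arguments.
Unset Strict Implicit.
Unset Printing Implicit Defensive.

Import Order.TTheory.
Local Open Scope order_scope.

Section OrderedSets.
Context {disp : Order.disp_t} {U : finPOrderType disp}.
Implicit Types (A C E P V W : {set U}) (DD S : {set {set U}}).

Definition antichain A : bool :=
  [forall x in A, forall y in A, (x >=< y) ==> (x == y)].

(* A is order-autonomous in the subset P, ordered by the induced order. *)
Definition order_autonomous P A : bool :=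
  [&& A != set0, A \subset P &
      [forall z in P :\: A,
         ([exists a in A, z < a] ==> [forall a in A, z < a]) &&
         ([exists a in A, a < z] ==> [forall a in A, a < z])]].

Definition nontrivial P A : bool := (#|A| != 1%N) && (#|A| != #|P|).

Definition structured DD : bool :=
  partition DD [set: U] && [forall E in DD, antichain E].

(* Products of permutations read left to right: (p * q) x = q (p x). *)
Definition autD DD : {set {perm U}} :=
  [set p : {perm U} | [forall x, forall y, (p x <= p y) == (x <= y)]
                      && [forall E in DD, p @: E == E]].

Lemma autDP DD (p : {perm U}) :
  reflect ((forall x y, (p x <= p y) = (x <= y)) /\
           (forall E, E \in DD -> p @: E = E))
          (p \in autD DD).
Proof.
rewrite inE; apply: (iffP andP) => -[h1 h2]; split.
- by move=> x y; exact/eqP/(forallP (forallP h1 x)).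
- by move=> E ED; exact/eqP/(forall_inP h2).
- by apply/forallP => x; apply/forallP => y; rewrite h1.
- by apply/forall_inP => E ED; rewrite h2.
Qed.

Lemma autD_group_set DD : group_set (autD DD).
Proof.
apply/group_setP; split.
  apply/autDP; split=> [x y|E _]; first by rewrite !perm1.
  rewrite -[RHS]imset_id; apply: eq_imset => x; exact: perm1.
move=> p q /autDP[p1 p2] /autDP[q1 q2]; apply/autDP; split=> [x y|E ED].
  by rewrite !permM q1 p1.
rewrite -[RHS](q2 _ ED) -{2}(p2 _ ED) -imset_comp.
by apply: eq_imset => x; rewrite permM.
Qed.
Canonical autD_group DD := Group (autD_group_set DD).

Definition Dorbits DD : {set {set U}} :=
  [set orbit 'P (autD DD) x | x in [set: U]].

Definition directly_interdependent C E : bool :=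
  [&& C != E, [exists c in C, exists e in E, (c < e) || (e < c)] &
      [exists c in C, exists e in E, c >< e]].

Definition orbit_graph DD : rel {set U} :=
  [rel C E | [&& C \in Dorbits DD, E \in Dorbits DD
               & directly_interdependent C E]].

Definition induced (T : finType) (S : {set T}) (e : rel T) : rel T :=
  [rel x y | [&& x \in S, y \in S & e x y]].

Definition connected_graph (T : finType) (S : {set T}) (e : rel T) : Prop :=
  {in S &, forall x y, connect (induced S e) x y}.

Definition is_component (T : finType) (S : {set T}) (e : rel T)
    (K : {set T}) : Prop :=
  exists2 x, x \in S & K = [set y | connect (induced S e) x y].

Definition interdependent_orbit_union DD : Prop :=
  structured DD /\ connected_graph (Dorbits DD) (orbit_graph DD).

Definition tight DD : Prop :=
  (forall E, E \in DD -> E \in Dorbits DD) /\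
  (forall E A, E \in DD -> A \subset E -> antichain A ->
     order_autonomous [set: U] A -> ~~ nontrivial [set: U] A).

End OrderedSets.

Section Construction.
Context {disp : Order.disp_t} {U : finPOrderType disp}.
(* Frames are numbered from 1: only the values D 1, ..., D m matter. *)
Context (D : nat -> {set U}) (m n s : nat).

Definition frames (k : nat) : {set {set U}} := [set D (nat_of_ord i).+1 | i : 'I_k].

Definition Wset : {set U} := [set: U] :\: \bigcup_(n <= j < m.+1) D j.

(* The sets A^j_i for i = 1, ..., l_j. *)
Definition blocks (j : nat) : {set {set U}} :=
  [set A | maxset (fun B : {set U} =>
     [&& B \subset D j, order_autonomous Wset B & antichain B]) A].

Definition all_blocks : {set {set U}} := \bigcup_(s <= j < n) blocks j.

Definition low : {set U} := \bigcup_(1 <= j < s) D j.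

Definition Qset : {set U} := \bigcup_(s <= j < m.+1) D j.

(* A choice of the points a^j_i is a function a with a A \in A on blocks. *)
Context (a : {set U} -> U).

Definition Un : {set U} := low :|: [set a A | A in all_blocks].

(* For x = a^j_i, pblock all_blocks x is A^j_i. The defaults (x itself) are
   never used when Phi is in Aut_D(U), see collapse_low and collapse_block. *)
Definition collapse (Phi : {perm U}) : {ffun {x | x \in Un} -> {x | x \in Un}} :=
  [ffun x => insubd x
     (if val x \in low then Phi (val x)
      else odflt (val x)
             [pick y in (Phi @: pblock all_blocks (val x)) :&: Un])].

Section CollapseCorrect.
Context (DD : {set {set U}}).
Context (hDD : DD = frames m) (hst : structured DD).
Context (hinj :
  forall i j, (1 <= i <= m)%N -> (1 <= j <= m)%N -> D i = D j -> i = j).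
Context (hs : (1 <= s <= n.-1)%N) (hn : (n <= m)%N).
Context (ha : forall j, (s <= j <= n.-1)%N ->
  forall A, A \in blocks j -> a A \in A).

Let memD j : (1 <= j <= m)%N -> D j \in DD.
Proof.
case: j => // j /andP[_ jm]; rewrite hDD; apply/imsetP.
by exists (Ordinal jm).
Qed.

Let n_gt0 : (0 < n)%N.
Proof. by move: hs; case: (n) => // /andP[]; case: (s). Qed.

Let range_m j : (s <= j < n)%N -> (1 <= j <= m)%N.
Proof.
case/andP=> sj jn; case/andP: hs => s1 _.
by rewrite (leq_trans s1 sj) (leq_trans (ltnW jn) hn).
Qed.

Let range_low j : (1 <= j < s)%N -> (1 <= j <= m)%N.
Proof.
case/andP=> j1 js; case/andP: hs => _ sn; rewrite j1 /=.
by rewrite (leq_trans (ltnW js)) // (leq_trans sn) // (leq_trans (leq_pred _)).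
Qed.

Let disjD i j x : (1 <= i <= m)%N -> (1 <= j <= m)%N ->
  x \in D i -> x \in D j -> i = j.
Proof.
move=> im jm xi xj; apply: hinj => //; apply/eqP/negP => /negP ne.
case/andP: hst => /and3P[_ /trivIsetP tr _] _.
have /pred0P/(_ x) := tr _ _ (memD im) (memD jm) ne.
by rewrite /= xi xj.
Qed.

Let antiD j (B : {set U}) : (1 <= j <= m)%N -> B \subset D j -> antichain B.
Proof.
move=> jm /subsetP sB; case/andP: hst => _ /forall_inP/(_ _ (memD jm)) aD.
apply/forall_inP => x xB; apply/forall_inP => y yB.
exact: (forall_inP (forall_inP aD x (sB _ xB)) y (sB _ yB)).
Qed.

Let mem_big_D lo hi x :
  (x \in \bigcup_(lo <= j < hi) D j) = has (fun j => x \in D j) (index_iota lo hi).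
Proof.
elim: (index_iota lo hi) => [|k r IH] /=; first by rewrite big_nil inE.
by rewrite big_cons inE IH.
Qed.

Let all_blocksP A :
  reflect (exists2 j, (s <= j < n)%N & A \in blocks j) (A \in all_blocks).
Proof.
have -> : (A \in all_blocks) = has (fun j => A \in blocks j) (index_iota s n).
  rewrite /all_blocks; elim: (index_iota s n) => [|k r IH] /=.
    by rewrite big_nil inE.
  by rewrite big_cons inE IH.
apply: (iffP hasP) => -[j]; rewrite ?mem_index_iota => h1 h2; exists j => //.
by rewrite mem_index_iota.
Qed.

Let lowP x :
  reflect (exists2 j, (1 <= j < s)%N & x \in D j) (x \in low).
Proof.
rewrite mem_big_D; apply: (iffP hasP) => -[j];
  rewrite ?mem_index_iota => h1 h2; exists j => //.
by rewrite mem_index_iota.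
Qed.

Let auto_setU (A B : {set U}) x : x \in A -> x \in B ->
  order_autonomous Wset A -> order_autonomous Wset B ->
  order_autonomous Wset (A :|: B).
Proof.
move=> xA xB /and3P[A0 AW /forall_inP hA] /and3P[_ BW /forall_inP hB].
apply/and3P; split; first by apply/set0Pn; exists x; rewrite inE xA.
  by rewrite subUset AW.
apply/forall_inP => z; rewrite !inE negb_or -andbA => /and3P[zA zB zW].
have {}/hA/andP[/implyP A1 /implyP A2] : z \in Wset :\: A by rewrite !inE zA zW.
have {}/hB/andP[/implyP B1 /implyP B2] : z \in Wset :\: B by rewrite !inE zB zW.
have up : z < x -> [forall b in A :|: B, z < b].
  move=> zx; apply/forall_inP => b; rewrite inE => /orP[] bI.
    by apply: (forall_inP (A1 _)) => //; apply/exists_inP; exists x.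
  by apply: (forall_inP (B1 _)) => //; apply/exists_inP; exists x.
have down : x < z -> [forall b in A :|: B, b < z].
  move=> zx; apply/forall_inP => b; rewrite inE => /orP[] bI.
    by apply: (forall_inP (A2 _)) => //; apply/exists_inP; exists x.
  by apply: (forall_inP (B2 _)) => //; apply/exists_inP; exists x.
apply/andP; split; apply/implyP => /exists_inP[b]; rewrite inE => /orP[] bI zb.
- by apply: up; apply: (forall_inP (A1 _)) => //; apply/exists_inP; exists b.
- by apply: up; apply: (forall_inP (B1 _)) => //; apply/exists_inP; exists b.
- by apply: down; apply: (forall_inP (A2 _)) => //; apply/exists_inP; exists b.
- by apply: down; apply: (forall_inP (B2 _)) => //; apply/exists_inP; exists b.
Qed.

Let blocks_sub j (A : {set U}) : A \in blocks j -> A \subset D j.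
Proof. by rewrite inE => /maxsetp/and3P[]. Qed.

Let blocks_eq (A B : {set U}) x : A \in all_blocks -> B \in all_blocks ->
  x \in A -> x \in B -> A = B.
Proof.
move=> /all_blocksP[i ir Ai] /all_blocksP[j jr Bj] xA xB.
have im := range_m ir; have jm := range_m jr.
have ij : i = j.
  apply: (disjD im jm (x := x)).
    exact: (subsetP (blocks_sub Ai)).
  exact: (subsetP (blocks_sub Bj)).
subst j; move: (Ai) (Bj); rewrite !inE => mA mB.
have /and3P[sA oA _] := maxsetp mA; have /and3P[sB oB _] := maxsetp mB.
have sU : A :|: B \subset D i by rewrite subUset sA.
have pU : [&& A :|: B \subset D i, order_autonomous Wset (A :|: B)
            & antichain (A :|: B)].
  by rewrite sU (auto_setU xA xB) // (antiD im sU).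
have <- := maxsetsup mA pU (subsetUl _ _).
by have -> := maxsetsup mB pU (subsetUr _ _).
Qed.

Let aut_D (Phi : {perm U}) j : Phi \in autD DD -> (1 <= j <= m)%N ->
  forall x, (Phi x \in D j) = (x \in D j).
Proof.
move=> /autDP[_ st] jm x; rewrite -{1}(st _ (memD jm)).
by rewrite mem_imset //; exact: perm_inj.
Qed.

Let aut_W (Phi : {perm U}) : Phi \in autD DD ->
  forall x, (Phi x \in Wset) = (x \in Wset).
Proof.
move=> aP x; rewrite !inE !mem_big_D !andbT; congr (~~ _).
apply: eq_in_has => j; rewrite mem_index_iota ltnS => /andP[nj jm].
by apply: aut_D => //; rewrite (leq_trans n_gt0 nj).
Qed.

Let aut_auto (Phi : {perm U}) (A : {set U}) : Phi \in autD DD ->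
  order_autonomous Wset A -> order_autonomous Wset (Phi @: A).
Proof.
move=> aP /and3P[A0 AW /forall_inP hA].
have ltP x y : (Phi x < Phi y) = (x < y).
  by case/autDP: aP => le _; rewrite !lt_def !le (inj_eq perm_inj).
apply/and3P; split.
- by case/set0Pn: A0 => x xA; apply/set0Pn; exists (Phi x); apply: imset_f.
- by apply/subsetP => _ /imsetP[x xA ->]; rewrite aut_W // (subsetP AW).
- apply/forall_inP => z'; rewrite -[z'](permKV Phi); set z := (Phi^-1)%g z'.
  rewrite inE mem_imset; last exact: perm_inj.
  rewrite aut_W // => zA; have /hA/andP[/implyP h1 /implyP h2] : z \in Wset :\: A.
    by rewrite inE.
  apply/andP; split; apply/implyP => /exists_inP[_ /imsetP[b bA ->]];
    rewrite ltP => zb; apply/forall_inP => _ /imsetP[c cA ->]; rewrite ltP.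
    by apply: (forall_inP (h1 _)) => //; apply/exists_inP; exists b.
  by apply: (forall_inP (h2 _)) => //; apply/exists_inP; exists b.
Qed.

Let aut_blocks (Phi : {perm U}) j (A : {set U}) : (s <= j < n)%N -> Phi \in autD DD ->
  A \in blocks j -> Phi @: A \in blocks j.
Proof.
move=> jr aP; have jm := range_m jr.
have fwd (Psi : {perm U}) (B : {set U}) : Psi \in autD DD ->
  [&& B \subset D j, order_autonomous Wset B & antichain B] ->
  [&& Psi @: B \subset D j, order_autonomous Wset (Psi @: B)
    & antichain (Psi @: B)].
  move=> aPs /and3P[sB oB _].
  have sPB : Psi @: B \subset D j.
    apply/subsetP => _ /imsetP[x xB ->].
    by rewrite aut_D // (subsetP sB).
  by rewrite sPB aut_auto // (antiD jm sPB).
rewrite !inE => mA; apply/maxsetP; split; first exact/fwd/(maxsetp mA).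
move=> B pB sAB.
have aPV : (Phi^-1)%g \in autD DD by rewrite groupV.
have -> : A = Phi^-1%g @: B.
  apply/esym/(maxsetsup mA); first exact: fwd.
  apply/subsetP => x xA; rewrite -[x](permK Phi).
  by apply: imset_f; apply: (subsetP sAB); apply: imset_f.
rewrite -imset_comp -[LHS]imset_id; apply: eq_imset => x /=; by rewrite permKV.
Qed.

Let in_block_low (A : {set U}) x : A \in all_blocks -> x \in A -> x \in low -> False.
Proof.
move=> /all_blocksP[j jr Aj] xA /lowP[i ir xi].
have ij := disjD (range_low ir) (range_m jr) xi (subsetP (blocks_sub Aj) _ xA).
by move: ir jr; rewrite ij => /andP[_ lt] /andP[le _]; rewrite ltnNge le in lt.
Qed.

Let aT (A : {set U}) : A \in all_blocks -> a A \in A.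
Proof.
move=> /all_blocksP[j /andP[sj jn] Aj]; apply: (ha (j := j)) => //.
by rewrite sj -ltnS prednK.
Qed.

Let block_capUn (A : {set U}) : A \in all_blocks -> A :&: Un = [set a A].
Proof.
move=> AB; apply/setP => y; rewrite !inE; apply/andP/eqP => [[yA]|->].
  case/orP => [/(in_block_low AB yA)//|/imsetP[B BB yE]].
  by rewrite yE (blocks_eq AB BB yA) // yE aT.
by rewrite aT // imset_f ?orbT.
Qed.

Lemma collapse_low (Phi : {perm U}) (x : {x | x \in Un}) :
  Phi \in autD DD -> val x \in low -> val (collapse Phi x) = Phi (val x).
Proof.
move=> aP xl; rewrite ffunE xl; apply: insubdK; rewrite -topredE /= inE.
apply/orP; left; case/lowP: xl => j jr xj; apply/lowP; exists j => //.
by rewrite aut_D // range_low.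
Qed.

Lemma collapse_block (Phi : {perm U}) (A : {set U}) (x : {x | x \in Un}) :
  Phi \in autD DD -> A \in all_blocks -> val x = a A ->
  (Phi @: A) :&: Un = [set val (collapse Phi x)].
Proof.
move=> aP AB xE.
have PB : Phi @: A \in all_blocks.
  case/all_blocksP: (AB) => j jr Aj; apply/all_blocksP; exists j => //.
  exact: aut_blocks.
have tr : trivIset all_blocks.
  apply/trivIsetP => B C BB CB ne; apply/pred0P => y /=.
  apply/negP => /andP[yB yC]; case/eqP: ne; exact: (blocks_eq BB CB yB yC).
have xA : val x \in A by rewrite xE aT.
rewrite ffunE (def_pblock tr AB xA) block_capUn //.
case: ifP => [/(in_block_low AB xA)//|_].
case: pickP => [y /set1P ->|/(_ (a (Phi @: A)))]; last by rewrite /= set11.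
by rewrite /= insubdK // -topredE /= inE imset_f ?orbT.
Qed.

End CollapseCorrect.

Definition fixing (G : {set {perm U}}) : {set {perm U}} :=
  [set Psi in G | collapse Psi == [ffun x => x]].

Definition restrQ (Psi : {perm U}) : {ffun {x | x \in Qset} -> U} :=
  [ffun x => Psi (val x)].

End Construction.

(* Main.v *)
(* [Phi |-> Phi_n] is compatible with composition, because [Phi] permutes the
   blocks [A^j_i] and [Phi_n] records this permutation on their
   representatives. It is therefore an action of [G] on [U_n] whose kernel is
   [H], and the first isomorphism theorem applies. An element of [H] is the
   identity outside [Q], so it is determined by its restriction to [Q]. *)
Require Import Defs.
From mathcomp Require Import all_boot all_order all_fingroup.

Set Implicit Arguments.
Unset Strict Implicit.
Unset Printing Implicit Defensive.

Import Order.TTheory.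

(** Each [c p] is bijective because [c p^-1] undoes it, so an action by plain functions lifts to
    permutations, where the isomorphism theorems are available. The order in [c q \o c p] matches
    the left-to-right product of permutations. *)
Lemma morphism_of_ffun_action (gT : finGroupType) (T : finType) (G : {group gT})
    (c : gT -> {ffun T -> T}) :
    c 1%g =1 id -> {in G &, forall p q, c (p * q)%g =1 c q \o c p} ->
  exists f : {morphism G >-> {perm T}}, {in G, forall p, f p =1 c p}.
Proof.
(* The default [1] is never taken on [G]: [fE] proves [c p] injective there. *)
move=> c1 cM; pose f p : {perm T} := insubd (1%g : {perm T}) (c p).
have fE : {in G, forall p, f p =1 c p}.
  move=> p pG x; rewrite -pvalE -[pval _]/(val (f p)) insubdK //.
  apply/injectiveP/(can_inj (g := c p^-1%g)) => y.
  by rewrite -[LHS]/((c p^-1%g \o c p) y) -cM ?groupV // mulgV c1.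
have fM : {in G &, {morph f : p q / (p * q)%g}}.
  by move=> p q pG qG; apply/permP => x; rewrite permM !fE ?groupM // cM.
by exists (Morphism fM).
Qed.

Lemma mem_bigcup_nat (T : finType) (F : nat -> {set T}) lo hi x :
  (x \in \bigcup_(lo <= j < hi) F j) = has (fun j => x \in F j) (index_iota lo hi).
Proof.
rewrite (big_morph (fun A : {set T} => x \in A) (id1 := false) (op1 := orb)).
- by rewrite big_has.
- by move=> A B; rewrite inE.
- by rewrite inE.
Qed.

Lemma bigcup_natP (T : finType) (F : nat -> {set T}) lo hi x :
  reflect (exists2 j, (lo <= j < hi)%N & x \in F j)
          (x \in \bigcup_(lo <= j < hi) F j).
Proof.
rewrite mem_bigcup_nat.
by apply: (iffP hasP) => -[j jr xj]; exists j => //;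
  rewrite mem_index_iota in jr *.
Qed.

(** * Transport of order notions along frame-preserving automorphisms *)

Section OrderAutomorphisms.
Context {disp : Order.disp_t} {U : finPOrderType disp} {DD : {set {set U}}}.
Implicit Types (p : {perm U}) (A W E : {set U}).

Lemma mem_frame_aut p E x :
  p \in autD DD -> E \in DD -> (p x \in E) = (x \in E).
Proof.
move=> /autDP[_ pD] ED.
by rewrite -{1}(pD _ ED) mem_imset //; exact: perm_inj.
Qed.

Lemma lt_aut p x y : p \in autD DD -> (p x < p y)%O = (x < y)%O.
Proof. by case/autDP => le_p _; rewrite !lt_def !le_p (inj_eq perm_inj). Qed.

Lemma antichain_aut p A : p \in autD DD -> antichain A -> antichain (p @: A).
Proof.
case/autDP => le_p _ /forall_inP aA.
apply/forall_inP => _ /imsetP[x xA ->]; apply/forall_inP => _ /imsetP[y yA ->].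
rewrite /Order.comparable !le_p (inj_eq perm_inj).
exact: (forall_inP (aA x xA) y yA).
Qed.

Lemma order_autonomous_aut p W A :
    p \in autD DD -> (forall x, (p x \in W) = (x \in W)) ->
  order_autonomous W A -> order_autonomous W (p @: A).
Proof.
move=> pD pW /and3P[A0 AW /forall_inP hA]; apply/and3P; split.
- by rewrite imset_eq0.
- by apply/subsetP => _ /imsetP[x xA ->]; rewrite pW (subsetP AW).
(* Writing the outside point as [p z] pulls every comparison back to [A]. *)
apply/forall_inP => z'; rewrite -[z'](permKV p); set z := (p^-1)%g z'.
rewrite inE mem_imset ?pW; last exact: perm_inj.
rewrite -in_setD => /hA/andP[/implyP below /implyP above].
apply/andP; split; apply/implyP => /exists_inP[_ /imsetP[b bA ->]];
  rewrite (lt_aut _ _ pD) => zb; apply/forall_inP => _ /imsetP[c cA ->];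
  rewrite (lt_aut _ _ pD).
- by apply: (forall_inP (below _)) => //; apply/exists_inP; exists b.
- by apply: (forall_inP (above _)) => //; apply/exists_inP; exists b.
Qed.

End OrderAutomorphisms.

(** * The action on blocks and the kernel's restriction to [Qset] *)

Section Collapse.
Context {disp : Order.disp_t} {U : finPOrderType disp}.
Context (D : nat -> {set U}) (m n s : nat) (a : {set U} -> U).
Context (hst : structured (frames D m)).
Context (hinj :
  forall i j, 1 <= i <= m -> 1 <= j <= m -> D i = D j -> i = j).
Context (hs : 1 <= s <= n.-1) (hn : n <= m).
Context (ha : forall j, s <= j <= n.-1 ->
  forall A, A \in blocks D m n j -> a A \in A).
Implicit Types (p q : {perm U}) (A B : {set U}).

Lemma mem_frames j : 1 <= j <= m -> D j \in frames D m.
Proof.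
case: j => // j /andP[_ jm]; apply/imsetP.
by exists (Ordinal jm).
Qed.

Lemma frame_cover x : exists2 j, 1 <= j <= m & x \in D j.
Proof.
case/andP: hst => /and3P[/eqP cov _ _] _.
have: x \in cover (frames D m) by rewrite cov inE.
by case/bigcupP => _ /imsetP[i _ ->] xi; exists i.+1 => //=.
Qed.

(** Every frame is preserved setwise, hence so is a union of consecutive frames. This serves [low]
    directly and [Wset] through its complement. *)
Lemma mem_bigcup_aut p lo hi x :
    p \in autD (frames D m) -> 1 <= lo -> hi <= m.+1 ->
  (p x \in \bigcup_(lo <= j < hi) D j) = (x \in \bigcup_(lo <= j < hi) D j).
Proof.
move=> pD lo1 him; rewrite !mem_bigcup_nat; apply: eq_in_has => j.
rewrite mem_index_iota => /andP[loj jhi]; apply: (mem_frame_aut _ pD).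
by rewrite mem_frames // (leq_trans lo1 loj) -ltnS (leq_trans jhi him).
Qed.

Lemma mem_low_aut p x :
  p \in autD (frames D m) -> (p x \in low D s) = (x \in low D s).
Proof.
move=> pD; apply: mem_bigcup_aut => //.
by case/andP: hs => _ /leq_trans->//; rewrite (leq_trans (leq_pred n)) // ltnW.
Qed.

Lemma blocks_aut p j A :
    p \in autD (frames D m) -> 1 <= j <= m ->
  A \in blocks D m n j -> p @: A \in blocks D m n j.
Proof.
move=> pD jm.
have n_gt0 : 1 <= n by case/andP: hs; case: (s) => // k _; case: (n).
set P := fun B : {set U} =>
  [&& B \subset D j, order_autonomous (Wset D m n) B & antichain B].
have PM q B : q \in autD (frames D m) -> P B -> P (q @: B).
  move=> qD /and3P[sB oB aB]; apply/and3P; split.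
  - case/autDP: (qD) => _ qD'.
    by rewrite -(qD' _ (mem_frames jm)) imsetS.
  - apply: (order_autonomous_aut qD) => // x.
    by rewrite !inE mem_bigcup_aut.
  - exact: (antichain_aut qD).
rewrite !inE => mA; apply/maxsetP; split; first exact/PM/(maxsetp mA).
move=> B PB sAB.
(* Maximality transfers through the inverse: a competitor [B] above [p @: A] pulls back to a
   competitor above [A], which must be [A]. *)
have pBA : p^-1%g @: B = A.
  apply: (maxsetsup mA); first by apply: PM; rewrite ?groupV.
  apply/subsetP => x xA; rewrite -[x](permK p).
  by apply/imset_f/(subsetP sAB)/imset_f.
rewrite -pBA -imset_comp -[LHS]imset_id.
by apply: eq_imset => x /=; rewrite permKV.
Qed.

Lemma all_blocks_aut p A :
    p \in autD (frames D m) ->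
  A \in all_blocks D m n s -> p @: A \in all_blocks D m n s.
Proof.
move=> pD /bigcup_natP[j /andP[sj jn] Aj]; apply/bigcup_natP.
exists j; rewrite ?sj //; apply: blocks_aut => //.
by case/andP: hs => s1 _; rewrite (leq_trans s1 sj) (leq_trans (ltnW jn)).
Qed.

Lemma rep_mem_block A : A \in all_blocks D m n s -> a A \in A.
Proof.
case/bigcup_natP => j /andP[sj jn] Aj; apply: (ha (j := j)) => //.
by rewrite sj -ltnS (ltn_predK jn).
Qed.

Lemma UnP x :
  reflect (x \in low D s \/ exists2 A, A \in all_blocks D m n s & x = a A)
          (x \in Un D m n s a).
Proof.
rewrite inE; apply: (iffP orP) => -[]; [by left| |by left|].
  by move=> /imsetP; right.
by move=> ex; right; apply/imsetP.
Qed.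

(** [collapse_block] leaves one point of [Un] in [p @: A], and the representative of that block is
    such a point. Values of [collapse] thus become images of blocks, which compose well. *)
Lemma collapse_rep p A (x : {x | x \in Un D m n s a}) :
    p \in autD (frames D m) -> A \in all_blocks D m n s -> val x = a A ->
  val (collapse D m n s a p x) = a (p @: A).
Proof.
move=> pD AB xE; have pAB := all_blocks_aut pD AB; apply/esym/set1P.
rewrite -(collapse_block (erefl _) hst hinj hs hn ha pD AB xE) inE.
by rewrite rep_mem_block //; apply/UnP; right; exists (p @: A).
Qed.

Lemma collapse1 : collapse D m n s a 1%g =1 id.
Proof.
move=> x; apply: val_inj; case/UnP: (valP x) => [xl|[A AB xE]].
  by rewrite (collapse_low (erefl _) hs hn) ?group1 // perm1.
rewrite (collapse_rep (group1 _) AB xE) xE; congr a.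
by rewrite -[RHS]imset_id; apply: eq_imset => y; rewrite perm1.
Qed.

Lemma collapseM : {in autD (frames D m) &, forall p q,
  collapse D m n s a (p * q)%g =1 collapse D m n s a q \o collapse D m n s a p}.
Proof.
move=> p q pD qD x; have pqD := groupM pD qD; apply: val_inj => /=.
case/UnP: (valP x) => [xl|[A AB xE]].
  have low_c r (y : {x | x \in Un D m n s a}) :=
    collapse_low (erefl _) hs hn (Phi := r) (x := y).
  (* The intermediate point [p x] stays in [low], so [collapse_low] applies to both factors. *)
  by rewrite !low_c ?permM ?mem_low_aut.
rewrite (collapse_rep pqD AB xE).
(* The inner value is the representative of the block [p @: A], so [collapse_rep] applies a second
   time. *)
rewrite (collapse_rep qD (all_blocks_aut pD AB) (collapse_rep pD AB xE)).
by rewrite -imset_comp; congr a; apply: eq_imset => y; rewrite permM.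
Qed.

Lemma restrQ_inj_fixing (G : {set {perm U}}) :
    G \subset autD (frames D m) ->
  {in fixing D m n s a G &, injective (restrQ D m s)}.
Proof.
move=> /subsetP GD.
have fix_low p x : p \in fixing D m n s a G -> x \in low D s -> p x = x.
  rewrite inE => /andP[/GD pD /eqP cp] xl.
  have xU : x \in Un D m n s a by apply/UnP; left.
  have := collapse_low (erefl _) hs hn (x := Sub x xU) pD xl.
  by rewrite cp ffunE.
move=> p q pH qH /ffunP eq_pq; apply/permP => x.
have [j /andP[j1 jm] xj] := frame_cover x.
(* The frames cover [U]. Those with index below [s] lie in [Un], where a trivial collapse forces
   [p x = x]; all others lie in [Qset]. *)
have [js | sj] := ltnP j s.
  have xl : x \in low D s by apply/bigcup_natP; exists j; rewrite ?j1.
  by rewrite !fix_low.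
have xQ : x \in Qset D m s by apply/bigcup_natP; exists j; rewrite ?sj ?ltnS.
by have := eq_pq (Sub x xQ); rewrite !ffunE.
Qed.

End Collapse.

Theorem theorem4p13 (disp : Order.disp_t) (U : finPOrderType disp)
  (DD : {set {set U}}) (m n s : nat) (D : nat -> {set U})
  (a : {set U} -> U) (G : {group {perm U}})
  (hUnion : interdependent_orbit_union DD)
  (hTight : tight DD)
  (hDD : DD = frames D m)
  (hDinj : forall i j, 1 <= i <= m -> 1 <= j <= m -> D i = D j -> i = j)
  (hm : 3 <= m) (hn : 3 <= n <= m) (hs : 1 <= s <= n.-1)
  (hComp : is_component (Dorbits DD :\ D n) (orbit_graph DD) (frames D n.-1))
  (hAdj : forall j, 1 <= j <= n.-1 -> orbit_graph DD (D j) (D n) = (s <= j))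
  (ha : forall j, s <= j <= n.-1 -> forall A, A \in blocks D m n j -> a A \in A)
  (hG : G \subset autD DD) :
  let H := fixing D m n s a G in
  [/\ group_set H,
      (H <| G)%g,
      (exists2 K : {group {perm {x | x \in Un D m n s a}}},
         [set [ffun x => p x] | p : {perm _} in K]
           = [set collapse D m n s a Phi | Phi in G]
         & (G / H \isog K)%g)
    & #|G| = #|[set collapse D m n s a Phi | Phi in G]|
             * #|[set restrQ D m s Psi | Psi in H]|].
Proof.
subst DD; case: hUnion => hst _; case/andP: hn => _ nm.
have cM := collapseM hst hDinj hs nm ha.
have [f fE] : exists f : {morphism G >-> {perm {x | x \in Un D m n s a}}},
    {in G, forall p, f p =1 collapse D m n s a p}.
  apply: morphism_of_ffun_action; first exact: collapse1.
  by move=> p q /(subsetP hG) pD /(subsetP hG) qD; exact: cM.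
(* Once [H] is a kernel, the group property, normality and the quotient all come from [f]. *)
have HE : fixing D m n s a G = ('ker f)%g.
  apply/setP => p; rewrite inE; apply/andP/idP => [[pG /eqP cp]|pK].
    by apply/kerP => //; apply/permP => x; rewrite fE // cp ffunE perm1.
  have pG := dom_ker pK; split=> //; apply/eqP/ffunP => x.
  by rewrite -fE // (mker pK) perm1 ffunE.
have KE : [set [ffun x => p x] | p : {perm _} in (f @* G)%g]
    = [set collapse D m n s a Phi | Phi in G].
  rewrite morphimEdom -imset_comp; apply: eq_in_imset => p pG /=.
  by apply/ffunP => x; rewrite ffunE fE.
(* Restriction to [Qset] is injective on [H], so the second factor of the product is the order of
   the kernel. *)
have cardH := card_in_imset (restrQ_inj_fixing hst hs nm hG (a := a)).
rewrite /= cardH HE; split.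
- exact: groupP.
- exact: ker_normal.
- by exists (f @* G)%G => //; exact: first_isog.
(* Reading permutations as functions is injective, so the first factor is the order of [f @* G],
   which is the index of the kernel. *)
rewrite -KE card_imset; last first.
  by move=> p q /ffunP eq_pq; apply/permP => x; have := eq_pq x; rewrite !ffunE.
rewrite card_morphim setIid mulnC Lagrange //; exact: subsetIl.
Qed.
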